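(* Let $G$ be a finite simple graph. Then $0\le \mathrm{gcol}(G)-\mathrm{gcol}(G-x)\le 2$ for every $x\in V(G)$.
   Context: All graphs are finite and simple; $G-x$ is the graph obtained from $G$ by deleting the vertex $x$. For a linear ordering $\tau$ of all vertices of $G=(V,E)$ and $v\in V$, let $N_G^+(\tau,v)$ be the set of neighbors $u$ of $v$ in $G$ with $u<_\tau v$, let $N_G^+[\tau,v]=N_G^+(\tau,v)\cup\{v\}$, and let $\mathrm{col}(G,\tau)=\max_{v\in V}|N_G^+[\tau,v]|$ (taken to be $0$ if $V=\emptyset$). In the ordering game on $G$, Alice and Bob, with Alice moving first, alternately choose a not-yet-chosen vertex of $G$ and append it to the end of the current sequence (initially empty) until all vertices are listed, giving a linear ordering $\tau$ of $V$. The score is $\mathrm{col}(G,\tau)$; Alice tries to minimize it and Bob tries to maximize it. The game coloring number $\mathrm{gcol}(G)$ is the least $s$ such that Alice has a strategy guaranteeing a score of at most $s$ however Bob plays. *)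

(* Defs.v *)
From mathcomp Require Import all_boot.
From mathcomp Require Import boolp.

Set Implicit Arguments.
Unset Strict Implicit.
Unset Printing Implicit Defensive.

Record sgraph := SGraph {
  vertex :> finType;
  adj : rel vertex;
  adj_sym : symmetric adj;
  adj_irrefl : irreflexive adj }.

Section DeleteVertex.
Variables (G : sgraph) (x : G).

Definition del_adj : rel {y : G | y != x} :=
  fun u v => adj (val u) (val v).

Lemma del_adj_sym : symmetric del_adj.
Proof. by move=> u v; apply: adj_sym. Qed.

Lemma del_adj_irrefl : irreflexive del_adj.
Proof. by move=> u; apply: adj_irrefl. Qed.

Definition del_vertex : sgraph := SGraph del_adj_sym del_adj_irrefl.
End DeleteVertex.

(* A linear ordering of the vertices is the sequence listing them in increasing
   order, so u is below v in tau when [index u tau < index v tau]. *)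
Definition ordering (G : sgraph) (tau : seq G) : bool :=
  uniq tau && [forall v : G, v \in tau].

Definition Nplus (G : sgraph) (tau : seq G) (v : G) : {set G} :=
  [set u : G | adj v u && (index u tau < index v tau)].

Definition Nplus_closed (G : sgraph) (tau : seq G) (v : G) : {set G} :=
  v |: Nplus tau v.

Definition col (G : sgraph) (tau : seq G) : nat :=
  \max_(v : G) #|Nplus_closed tau v|.

(* Alice moves first, so she is to move at the unfinished positions (sequences
   of distinct vertices) of even length. *)
Definition alice_turn (G : sgraph) (p : seq G) : bool :=
  [&& uniq p, size p < #|G| & ~~ odd (size p)].

Definition strategy (G : sgraph) : Type :=
  forall p : seq G, alice_turn p -> {v : G | v \notin p}.

(* The final ordering tau is the outcome of a play in which Alice uses sigma;
   Bob's moves are unconstrained. *)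
Definition follows (G : sgraph) (sigma : strategy G) (tau : seq G) : Prop :=
  forall (p : seq G) (hp : alice_turn p),
    prefix p tau -> prefix (rcons p (val (sigma p hp))) tau.

Definition alice_guarantees (G : sgraph) (s : nat) : Prop :=
  exists sigma : strategy G,
    forall tau : seq G, ordering tau -> follows sigma tau -> col tau <= s.

Lemma alice_turn_legal (G : sgraph) (p : seq G) :
  alice_turn p -> exists v : G, v \notin p.
Proof.
case/and3P=> _ lt_p _; apply/existsP; apply: contraLR lt_p.
rewrite negb_exists -leqNgt => /forallP all_p.
apply: leq_trans (card_size p); apply/subset_leq_card/subsetP => v _.
by have := all_p v; rewrite negbK.
Qed.

Lemma alice_guarantees_card (G : sgraph) : alice_guarantees G #|G|.
Proof.
exists (fun p hp => exist _ (xchoose (alice_turn_legal hp))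
                            (xchooseP (alice_turn_legal hp))).
by move=> tau _ _; apply/bigmax_leqP => v _; apply: max_card.
Qed.

Lemma alice_guarantees_ex (G : sgraph) : exists s, `[< alice_guarantees G s >].
Proof. by exists #|G|; apply/asboolP/alice_guarantees_card. Qed.

Definition gcol (G : sgraph) : nat := ex_minn (alice_guarantees_ex G).

Lemma gcol_guarantees (G : sgraph) : alice_guarantees G (gcol G).
Proof. by rewrite /gcol; case: ex_minnP => s /asboolP. Qed.

Lemma gcol_min (G : sgraph) (s : nat) : alice_guarantees G s -> gcol G <= s.
Proof.
by move=> hs; rewrite /gcol; case: ex_minnP => m _; apply; apply/asboolP.
Qed.

(* Main.v *)
Require Import Defs.
From mathcomp Require Import all_boot all_order all_algebra.
From mathcomp Require Import boolp.

(** Writing d(v) for the number of neighbours of v listed before v, the score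
    exceeds s exactly when some vertex gets d(v) >= s.  Only the set C of listed
    vertices and the player to move matter for the rest of the game, so both
    inequalities are proved for the positional game on sets, from Bob's side:
    [bob_wins s t C] says that he can force a d(v) >= s from C, and
    [alice_guaranteesP] translates back to strategies.

    Call a vertex safe when its degree is below s: it can never reach d(v) >= s.
    If only unsafe vertices are left, Bob wins however the game goes on, because
    all the neighbours of the last vertex precede it.  Hence a Bob who is given
    an extra move either has won already or can spend it on a safe vertex; and
    listing a safe vertex early can only increase the d(v) of the others
    ([bob_wins_superset]).  So having to move never hurts Bob
    ([bob_wins_pass]), or, seen from the other side, an extra move never hurts
    Alice.

    Lower bound, for any subgraph H of G ([bob_wins_supergraph]): Bob transfers
    his play in H to G.  Whenever Alice lists a vertex outside H, she has passed
    in H, which does not hurt Bob.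

    Upper bound: one extra listed vertex b costs Alice at most one
    ([bob_wins_extra_chosen]).  She plays as if b were not listed, and every d(v)
    is off by at most one; if this play asks for b itself, she gets an
    extra move, which does not hurt her.  To play on G, Alice lists x first.
    This leaves G - x with Bob to start and x as an extra listed vertex, which
    costs one; once Bob has made his first move b, Alice starts on G - x with b
    as an extra listed vertex, which costs one more. *)

Set Implicit Arguments.
Unset Strict Implicit.
Unset Printing Implicit Defensive.

(** * The game on sets of listed vertices *)

Definition back_degree (G : sgraph) (C : {set G}) (v : G) : nat :=
  #|[set u in C | adj v u]|.

(** The boolean is true when Bob is to move.  [C] is the set of vertices listed
    so far, and the target is a back degree of at least [s], that is, a score
    above [s].  Only Bob's moves are credited with reaching the target at once;
    a move of Alice that reaches it is excluded from the alternatives that Bob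
    has to answer. *)
Inductive bob_wins (G : sgraph) (s : nat) : bool -> {set G} -> Prop :=
| bob_scores (C : {set G}) b of b \notin C & s <= back_degree C b :
    bob_wins s true C
| bob_moves (C : {set G}) b of b \notin C & bob_wins s false (b |: C) :
    bob_wins s true C
| alice_moves (C : {set G}) of C != setT &
    (forall a, a \notin C -> back_degree C a < s -> bob_wins s true (a |: C)) :
    bob_wins s false C.

Section PositionalGame.
Variables (G : sgraph) (s : nat).
Implicit Types (C D : {set G}) (t : bool).

Lemma back_degreeS C D v : C \subset D -> back_degree C v <= back_degree D v.
Proof.
move=> sCD; apply: subset_leq_card; apply/subsetP => u.
by rewrite !inE => /andP[/(subsetP sCD)-> ->].
Qed.

Lemma setT_neqP C : reflect (exists v, v \notin C) (C != setT).
Proof.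
apply: (iffP idP) => [|[v vC]]; last first.
  by apply: contraNneq vC => ->; rewrite inE.
by rewrite -subTset => /subsetPn[v _ vC]; exists v.
Qed.

Lemma cardsC_add C v : v \notin C -> #|~: (v |: C)| < #|~: C|.
Proof.
move=> vC; apply: proper_card; rewrite properC; apply/properP.
by split; [apply: subsetUr | exists v; rewrite ?setU11].
Qed.

(** Only an unsafe vertex can reach back degree [s], and the one that does is
    not listed yet. *)
Lemma bob_wins_unsafe t C :
  bob_wins s t C -> exists2 v, v \notin C & s <= back_degree setT v.
Proof.
elim=> {t C} [C b bC sb | C b bC _ [v vC sv] | C /setT_neqP[a aC] _ IH].
- by exists b => //; apply: leq_trans sb _; apply: back_degreeS; apply: subsetT.
- by exists v => //; apply: contra vC => vC; rewrite inE vC orbT.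
have [sa|/IH-/(_ aC)[v vC sv]] := leqP s (back_degree C a).
  by exists a => //; apply: leq_trans sa _; apply: back_degreeS; apply: subsetT.
by exists v => //; apply: contra vC => vC; rewrite inE vC orbT.
Qed.

(** Whichever vertex is listed last is preceded by all of its neighbours; being
    unsafe, it reaches back degree [s]. *)
Lemma bob_wins_all_unsafe t C :
  C != setT -> (forall v, v \notin C -> s <= back_degree setT v) ->
  bob_wins s t C.
Proof.
have [n le_n] := ubnP #|~: C|; elim: n t C le_n => // n IH t C le_n CT unsafe.
have step v t' : v \notin C -> back_degree C v < s -> bob_wins s t' (v |: C).
  move=> vC lt_s; apply: IH.
  - exact: leq_trans (cardsC_add vC) le_n.
  - apply: contraTneq lt_s => vCT; rewrite -leqNgt.
    (* [v] comes last and is not its own neighbour: all of them are in [C]. *)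
    apply: leq_trans (unsafe v vC) _; apply: subset_leq_card.
    apply/subsetP => u; rewrite !inE /= => uv; rewrite uv andbT.
    have := in_setT u; rewrite -vCT !inE => /predU1P[uE|//].
    by rewrite uE adj_irrefl in uv.
  - by move=> w; rewrite !inE negb_or => /andP[_]; apply: unsafe.
case: t; last by apply: alice_moves => // a; apply: step.
have [b bC] := setT_neqP C CT.
have [sb|lt_s] := leqP s (back_degree C b); first exact: bob_scores sb.
exact: bob_moves (step b false bC lt_s).
Qed.

(** Bob needs a plan only for the safe vertices: without any, he has won. *)
Lemma bob_wins_extra_move C :
  C != setT ->
  (forall v, v \notin C -> back_degree setT v < s -> bob_wins s false (v |: C)) ->
  bob_wins s true C.
Proof.
move=> CT win.
have [[v vC sv]|nosafe] := pselect (exists2 v, v \notin C & back_degree setT v < s).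
  exact: bob_moves (win v vC sv).
apply: bob_wins_all_unsafe => // v vC; rewrite leqNgt.
by apply/negP => sv; apply: nosafe; exists v.
Qed.

(** Bob follows his winning play from [C].  The additional vertices of [D]
    increase back degrees and leave Alice fewer choices.  If his play asks for a
    vertex that is already in [D], he has an extra move, which he spends on
    another safe vertex, unless only unsafe ones are left and he has won: this
    enlarges the difference between the two positions, but keeps all of it
    safe. *)
Lemma bob_wins_superset t C D :
  bob_wins s t C -> C \subset D ->
  (forall v, v \in D -> v \notin C -> back_degree setT v < s) ->
  bob_wins s t D.
Proof.
move=> win; elim: {t C} win D => [C b bC sb | C b bC win IH | C CT win IH] D sCD safe.
- have sbT : s <= back_degree setT b.
    by apply: leq_trans sb _; apply: back_degreeS; apply: subsetT.
  have bD : b \notin D.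
    by apply: contraTN sbT => bD; rewrite -ltnNge; apply: safe.
  by apply: bob_scores bD _; apply: leq_trans sb _; apply: back_degreeS.
- have [bD|bD] := boolP (b \in D); last first.
    apply: bob_moves bD _; apply: IH; first exact: setUS.
    move=> v; rewrite !inE negb_or => /predU1P[->|vD]; first by rewrite eqxx.
    by case/andP=> _; apply: safe.
  (* [b] is already listed in [D]; after any safe [v], the set [v |: D] covers
     [b |: C] with Alice to move. *)
  apply: bob_wins_extra_move => [|v vD sv].
    have [v vC sv] := bob_wins_unsafe win.
    apply/setT_neqP; exists v; apply: contraTN sv => vD.
    rewrite -ltnNge; apply: safe => //; apply: contra vC => vC.
    by rewrite inE vC orbT.
  apply: IH => [|w].
    by rewrite subUset sub1set !inE bD orbT (subset_trans sCD (subsetUr _ _)).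
  rewrite !inE negb_or => /predU1P[-> //|wD] /andP[_]; exact: safe.
have [v vC sv] := bob_wins_unsafe (alice_moves CT win).
have vD : v \notin D by apply: contraTN sv => vD; rewrite -ltnNge; apply: safe.
apply: alice_moves => [|a aD sa]; first by apply/setT_neqP; exists v.
apply: IH.
- by apply: contra aD; apply: (subsetP sCD).
- by apply: leq_ltn_trans sa; apply: back_degreeS.
- exact: setUS.
move=> w; rewrite !inE negb_or => /predU1P[->|wD]; first by rewrite eqxx.
by case/andP=> _; apply: safe.
Qed.

(** Bob uses the move on a safe vertex and is then in a superset of [C] with
    Alice to move; if there is no safe vertex, he has already won. *)
Lemma bob_wins_pass C : bob_wins s false C -> bob_wins s true C.
Proof.
move=> win; apply: bob_wins_extra_move => [|v vC sv].
  by have [v vC _] := bob_wins_unsafe win; apply/setT_neqP; exists v.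
apply: bob_wins_superset win (subsetUr _ _) _ => w.
by rewrite !inE => /predU1P[-> //|->].
Qed.

End PositionalGame.

(** * Transferring wins between graphs *)

Section CompareGraphs.
Variables (H G : sgraph) (h : H -> G).
Hypothesis h_inj : injective h.

(** A move of Alice outside the image of [h] is a pass in [H], handled by
    [bob_wins_pass].  That lemma builds a new win for Bob instead of exposing a
    part of the given one, so the induction is on the number of vertices
    of [G] left. *)
Lemma bob_wins_supergraph s t (C : {set H}) (D : {set G}) :
  (forall u v, adj u v -> adj (h u) (h v)) ->
  C = h @^-1: D -> bob_wins s t C -> bob_wins s t D.
Proof.
move=> h_hom; have [n le_n] := ubnP #|~: D|.
elim: n t C D le_n => // n IH t C D le_n defC.
have memC v : (v \in C) = (h v \in D) by rewrite defC inE.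
have le_deg v : back_degree C v <= back_degree D (h v).
  rewrite /back_degree -(card_imset _ h_inj); apply: subset_leq_card.
  apply/subsetP => _ /imsetP[u + ->]; rewrite !inE memC.
  by case/andP=> -> /h_hom.
have step v t' : v \notin C -> bob_wins s t' (v |: C) -> bob_wins s t' (h v |: D).
  rewrite memC => vD; apply: IH; first exact: leq_trans (cardsC_add vD) le_n.
  by apply/setP=> u; rewrite !inE memC (inj_eq h_inj).
move=> win; case: win defC memC le_deg step
  => [{}C b bC sb | {}C b bC win | {}C CT win] defC memC le_deg step.
- by apply: (@bob_scores _ _ _ (h b)); rewrite -?memC // (leq_trans sb).
- by apply: (@bob_moves _ _ _ (h b)); [rewrite -memC | apply: step].
apply: alice_moves => [|a aD sa].
  by have [v vC] := setT_neqP _ CT; apply/setT_neqP; exists (h v); rewrite -memC.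
have [[v av]|a_out] := pselect (exists v, a = h v).
  rewrite av in aD sa *; rewrite -memC in aD; apply: step => //.
  by apply: win => //; apply: leq_ltn_trans sa.
apply: IH (bob_wins_pass (alice_moves CT win)).
  exact: leq_trans (cardsC_add aD) le_n.
apply/setP=> u; rewrite !inE memC; case: eqP => // ua.
by case: a_out; exists u.
Qed.

(** Here [x] is the only vertex that may be listed in [G] without its preimage
    being listed in [H], so corresponding back degrees differ by at most one.
    It serves both for a vertex [x] that [H] lacks and, with [H = G], for a
    vertex that Alice pretends is not listed. *)
Lemma bob_wins_extra_chosen s t (x : G) (C : {set H}) (D : {set G}) :
  {mono h : u v / adj u v} ->
  h @: C \subset D -> D \subset x |: h @: C ->
  (forall w, w \notin D -> exists v, w = h v) ->
  bob_wins s.+1 t D -> bob_wins s t C.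
Proof.
move=> h_mono; have [n le_n] := ubnP #|~: C|.
elim: n t C D le_n => // n IH t C D le_n sCD sDC h_onto.
have outC v : h v \notin D -> v \notin C.
  by apply: contra => vC; apply: (subsetP sCD); apply: imset_f.
have le_deg v : back_degree D (h v) <= (back_degree C v).+1.
  rewrite /back_degree -(card_imset _ h_inj).
  apply: leq_trans (subset_leq_card (_ : _ \subset x |: h @: [set u in C | adj v u])) _.
    apply/subsetP=> w; rewrite !inE => /andP[/(subsetP sDC)].
    rewrite !inE => /predU1P[->|]; first by rewrite eqxx.
    case/imsetP=> u uC ->; rewrite h_mono => uv.
    by apply/orP; right; apply: imset_f; rewrite inE uC.
  by rewrite cardsU1; case: (_ \notin _).
have step v t' : v \notin C -> bob_wins s.+1 t' (h v |: D) ->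
    bob_wins s t' (v |: C).
  move=> vC; apply: IH.
  - exact: leq_trans (cardsC_add vC) le_n.
  - by rewrite imsetU1 setUS.
  - rewrite imsetU1 setUCA setUS //.
  - by move=> w; rewrite !inE negb_or => /andP[_]; apply: h_onto.
move=> win; case: win sCD sDC h_onto outC le_deg step
  => [{}D b bD sb | {}D b bD win | {}D DT win] sCD sDC h_onto outC le_deg step.
- have [v bv] := h_onto b bD; rewrite {b}bv in bD sb.
  by apply: (@bob_scores _ _ _ v); rewrite ?outC // -ltnS (leq_trans sb).
- have [v bv] := h_onto b bD; rewrite {b}bv in bD win.
  by apply: (@bob_moves _ _ _ v); rewrite ?outC //; apply: step; rewrite ?outC.
apply: alice_moves => [|a aC sa].
  have [w wD] := setT_neqP _ DT; have [v wv] := h_onto w wD.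
  by apply/setT_neqP; exists v; apply: outC; rewrite -wv.
apply: step => //; have [aD|aD] := boolP (h a \in D); last first.
  by apply: win => //; apply: leq_ltn_trans (le_deg a) _.
(* Alice lists in [H] the vertex already listed in [G]: nothing changes in [G],
   where Alice has passed on her move. *)
have -> : h a |: D = D by apply/setUidPr; rewrite sub1set.
exact: bob_wins_pass (alice_moves DT win).
Qed.

End CompareGraphs.

(** * From sets back to strategies and orderings *)

Section Strategies.
Variables (G : sgraph) (s : nat).
Implicit Types (p q tau : seq G) (sigma : strategy G).

Lemma seq_set_rcons p v : [set u in rcons p v] = v |: [set u in p].
Proof. by apply/setP=> u; rewrite !inE mem_rcons in_cons. Qed.

Lemma prefix_rcons_inv q p v :
  prefix q (rcons p v) -> q = rcons p v \/ prefix q p.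
Proof.
rewrite !prefixE -cats1 take_cat; case: ltnP => [_ ->|le_pq]; first by right.
have [->|ne] := eqVneq (size q) (size p).
  by rewrite subnn take0 cats0 => /eqP->; right; rewrite take_size.
have lt : size p < size q by rewrite ltn_neqAle eq_sym ne.
by rewrite take_oversize => [/eqP->|]; [left|rewrite /= subn_gt0].
Qed.

(** The vertices below [v] in [tau] form the prefix of [tau] ending just before
    [v], so the score is read off the successive moves. *)
Lemma col_leqP tau : ordering tau ->
  Defs.col tau <= s <->
  (forall p v, prefix (rcons p v) tau -> back_degree [set u in p] v < s).
Proof.
case/andP=> uniq_tau /forallP tauT.
have before v : Nplus_closed tau v =
    v |: [set u in [set u in take (index v tau) tau] | adj v u].
  congr (_ |: _); apply/setP=> u; rewrite !inE in_take //; exact: andbC.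
have cardN v : #|Nplus_closed tau v| =
    (back_degree [set u in take (index v tau) tau] v).+1.
  by rewrite before cardsU1 !inE adj_irrefl andbF.
split=> [/bigmax_leqP le_s p v /prefixP[r def_tau] | lt_s].
  have <- : take (index v tau) tau = p.
    have vp : v \notin p.
      by move: uniq_tau; rewrite def_tau cat_uniq rcons_uniq => /andP[/andP[]].
    rewrite def_tau -cats1 -catA /= index_cat (negbTE vp) /= eqxx addn0.
    by rewrite take_size_cat.
  by rewrite -cardN; apply: le_s.
apply/bigmax_leqP => v _; rewrite cardN; apply: lt_s.
have lt_v : index v tau < size tau by rewrite index_mem.
by rewrite -{2}(nth_index v (tauT v)) -take_nth // prefix_take.
Qed.

(** The version of [follows] for an unfinished play: the bound on [size q] is
    there because Alice's answer to [p] itself is not part of [p]. *)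
Definition follows_so_far sigma p : Prop :=
  forall q (hq : alice_turn q), size q < size p -> prefix q p ->
    prefix (rcons q (val (sigma q hq))) p.

Lemma follows_so_far_rcons sigma p v :
  follows_so_far sigma p -> (forall hp, v = val (sigma p hp)) ->
  follows_so_far sigma (rcons p v).
Proof.
move=> fol def_v q hq; rewrite size_rcons ltnS => le_qp pre.
have pre_q : prefix q p.
  have [eq_q|//] := prefix_rcons_inv pre.
  by have := le_qp; rewrite eq_q size_rcons ltnn.
move: le_qp; rewrite leq_eqVlt => /orP[/eqP eq_sz|lt_qp].
  have eq_q : q = p by move: pre_q; rewrite prefixE eq_sz take_size => /eqP.
  by subst q; rewrite -def_v prefix_refl.
by apply: prefix_trans (fol q hq lt_qp pre_q) _; apply: prefix_rcons.
Qed.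

Lemma play_on sigma p :
  uniq p -> follows_so_far sigma p ->
  exists tau, [/\ ordering tau, follows sigma tau & prefix p tau].
Proof.
have [n le_n] := ubnP #|~: [set u in p]|.
elim: n p le_n => // n IH p le_n up fol.
have szE : #|[set u in p]| = size p by rewrite cardsE; apply/card_uniqP.
have [pT|pT] := eqVneq [set u in p] setT.
  have ordp : ordering p.
    by rewrite /ordering up; apply/forallP=> v; have := in_setT v; rewrite -pT inE.
  exists p; split=> [//|q hq|]; last exact: prefix_refl.
  apply: fol; rewrite -szE pT cardsT.
  by case/and3P: hq.
have [v vp def_v] : exists2 v, v \notin p & forall hp, v = val (sigma p hp).
  have [hp|nhp] := pselect (alice_turn p).
    exists (val (sigma p hp)); first exact: svalP (sigma p hp).
    by move=> hp'; rewrite (bool_irrelevance hp' hp).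
  have [v] := setT_neqP _ pT; rewrite inE => vp.
  by exists v.
have [||tau [ord f pre]] := IH (rcons p v) _ _ (follows_so_far_rcons fol def_v).
- by rewrite seq_set_rcons (leq_trans (cardsC_add _) le_n) // inE.
- by rewrite rcons_uniq vp.
by exists tau; split=> //; apply: prefix_trans pre; apply: prefix_rcons.
Qed.

(** Against a fixed strategy, Bob's win unfolds into a single play.  Once the
    target is reached, the play only has to be completed ([play_on]). *)
Lemma bob_wins_beats sigma t C : bob_wins s t C ->
  forall p, uniq p -> follows_so_far sigma p ->
    C = [set u in p] -> t = odd (size p) ->
  exists tau, [/\ ordering tau, follows sigma tau & s < Defs.col tau].
Proof.
have score p v : uniq p -> follows_so_far sigma p -> v \notin p ->
    (forall hp, v = val (sigma p hp)) -> s <= back_degree [set u in p] v ->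
    exists tau, [/\ ordering tau, follows sigma tau & s < Defs.col tau].
  move=> up fol vp def_v sv.
  have [|tau [ord f pre]] := play_on _ (follows_so_far_rcons fol def_v).
    by rewrite rcons_uniq vp.
  exists tau; split=> //; rewrite ltnNge; apply/negP => /(col_leqP ord) le_s.
  by have := le_s _ _ pre; rewrite ltnNge sv.
have odd_turn p v : true = odd (size p) -> forall hp, v = val (sigma p hp).
  by move=> op hp; case/and3P: (hp); rewrite -op.
elim=> {t C} [C b bC sb | C b bC _ IH | C CT _ IH] p up fol defC tp.
- by rewrite {C}defC in bC sb; apply: (score p b) => //; rewrite ?inE // in bC *;
    apply: odd_turn.
- rewrite {C}defC in bC IH; rewrite inE in bC; apply: (IH (rcons p b)).
  + by rewrite rcons_uniq bC.
  + by apply: follows_so_far_rcons => //; apply: odd_turn.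
  + by rewrite seq_set_rcons.
  + by rewrite size_rcons /= -tp.
rewrite {C}defC in CT IH.
have hp : alice_turn p.
  rewrite /alice_turn up -tp andbT /=.
  have <- : #|[set u in p]| = size p by rewrite cardsE; apply/card_uniqP.
  by rewrite -cardsT; apply: proper_card; rewrite properT.
pose a := val (sigma p hp).
have ap : a \notin p by exact: svalP (sigma p hp).
have def_a hp' : a = val (sigma p hp') by rewrite (bool_irrelevance hp' hp).
have [sa|lt_s] := leqP s (back_degree [set u in p] a).
  exact: score sa.
apply: (IH a _ lt_s (rcons p a)).
- by rewrite inE.
- by rewrite rcons_uniq ap.
- exact: follows_so_far_rcons.
- by rewrite seq_set_rcons.
- by rewrite size_rcons /= -tp.
Qed.

Definition good_reply p v : Prop :=
  back_degree [set u in p] v < s /\ ~ bob_wins s true [set u in rcons p v].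

(** Stated as an implication under the existential, so that choice yields a
    total strategy, arbitrary at the positions that Alice has already lost. *)
Lemma good_reply_ex p (hp : alice_turn p) :
  exists v : {v : G | v \notin p},
    ~ bob_wins s false [set u in p] -> good_reply p (val v).
Proof.
have [v0 v0p] := alice_turn_legal hp.
have [[v good]|none] := pselect (exists v : {v : G | v \notin p}, good_reply p (val v)).
  by exists v.
exists (exist _ v0 v0p) => lost; case: lost.
apply: alice_moves => [|a]; first by apply/setT_neqP; exists v0; rewrite inE.
rewrite inE => ap lt_s; apply: contrapT => lost; apply: none.
by exists (exist _ a ap); split=> //=; rewrite seq_set_rcons.
Qed.

(** The game is determined: if Bob does not win, Alice stays in positions that
    are not winning for him, and so no back degree ever reaches [s]. *)
Lemma alice_guaranteesP : alice_guarantees G s <-> ~ @bob_wins G s false set0.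
Proof.
have set_nil : [set u in [::]] = set0 :> {set G} by apply/setP=> u; rewrite !inE.
split=> [[sigma win_s] lost|win_A].
  have start : follows_so_far sigma [::] by [].
  have [tau [ord fol]] := bob_wins_beats lost (p := [::]) isT start (esym set_nil) erefl.
  by rewrite ltnNge win_s.
exists (fun p hp => sval (cid (good_reply_ex hp))) => tau ord fol.
set sigma : strategy G := (fun p hp => _) in fol.
have keep p v : prefix (rcons p v) tau -> ~ bob_wins s (odd (size p)) [set u in p] ->
    back_degree [set u in p] v < s /\
    ~ bob_wins s (odd (size (rcons p v))) [set u in rcons p v].
  move=> pre; case/andP: (ord) => uniq_tau _.
  have up : uniq (rcons p v).
    by case/prefixP: (pre) uniq_tau => r ->; rewrite cat_uniq => /andP[].
  have vp : v \notin p by move: up; rewrite rcons_uniq => /andP[].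
  rewrite size_rcons /=; case op: (odd (size p)) => /= win.
    split; last by move=> lost; apply: win; apply: (@bob_moves _ _ _ v);
      rewrite ?inE // -seq_set_rcons.
    by rewrite ltnNge; apply/negP => sv; apply: win; apply: bob_scores sv; rewrite inE.
  have hp : alice_turn p.
    rewrite /alice_turn op andbT; move: (up); rewrite rcons_uniq => /andP[_ ->] /=.
    by have /card_uniqP := up; rewrite size_rcons => <-; apply: max_card.
  have -> : v = val (sigma p hp).
    have := fol p hp (prefix_trans (prefix_rcons p v) pre).
    move: pre; rewrite !prefixE !size_rcons => /eqP-> /eqP.
    by case/rcons_inj.
  by rewrite /sigma; case: (cid _) => u /= /(_ win).
have never p : prefix p tau -> ~ bob_wins s (odd (size p)) [set u in p].
  elim/last_ind: p => [|p v IH] pre; first by rewrite set_nil.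
  by case: (keep p v pre (IH (prefix_trans (prefix_rcons p v) pre))).
apply/(col_leqP ord) => p v pre.
by case: (keep p v pre (never p (prefix_trans (prefix_rcons p v) pre))).
Qed.

End Strategies.

(** * The game coloring number *)

Lemma gcol_subgraph (H G : sgraph) (h : H -> G) :
  injective h -> (forall u v, adj u v -> adj (h u) (h v)) -> gcol H <= gcol G.
Proof.
move=> h_inj h_hom; apply: gcol_min; apply/alice_guaranteesP => win.
apply: (iffLR (alice_guaranteesP G _) (gcol_guarantees G)).
by apply: (bob_wins_supergraph h_inj h_hom _ win); apply/setP=> v; rewrite !inE.
Qed.

(** Alice opens with [x]; then [bob_wins_extra_chosen] is used twice on the
    target [s.+2], for [x] and for Bob's first move in [G - x]. *)
Lemma gcol_del_vertex (G : sgraph) (x : G) : gcol G <= (gcol (del_vertex x)).+2.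
Proof.
set H := del_vertex x; set s := gcol H.
apply: gcol_min; apply/alice_guaranteesP => win.
apply: (iffLR (alice_guaranteesP H s) (gcol_guarantees H)).
have deg0 (K : sgraph) (v : K) : back_degree set0 v = 0.
  by apply: eq_card0 => u; rewrite !inE.
(* Nothing is listed yet, so [x] gets back degree 0 and the game goes on. *)
have winB : bob_wins s.+2 true (x |: set0).
  by inversion win as [| |C CT win']; apply: win'; rewrite ?inE ?deg0.
have {}winB : @bob_wins H s.+1 true set0.
  apply: (@bob_wins_extra_chosen H G val val_inj s.+1 true x _ _ _ _ _ _ winB) => //.
  - by rewrite imset0 sub0set.
  - by rewrite imset0.
  move=> w; rewrite !inE orbF => wx.
  by exists (exist (fun y => y != x) w wx).
inversion winB as [C b _ sb|C b _ winA|]; first by rewrite deg0 in sb.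
apply: (@bob_wins_extra_chosen H H id (fun _ _ => id) s false b _ _ _ _ _ _ winA) => //.
- by rewrite imset0 sub0set.
- by rewrite imset0.
by move=> w _; exists w.
Qed.

Local Open Scope ring_scope.

Theorem lemma5 (G : sgraph) (x : G) :
  (0 <= (gcol G)%:Z - (gcol (del_vertex x))%:Z <= 2)%R.
Proof.
have lo : (gcol (del_vertex x) <= gcol G)%N.
  exact: (@gcol_subgraph (del_vertex x) G val val_inj).
have hi := gcol_del_vertex x.
by rewrite Num.Theory.subr_ge0 Num.Theory.lerBlDl -PoszD !lez_nat addn2 lo hi.
Qed.
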